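(* If $f,g\in L^1[0,\infty)$ are two synchronous functions and $\alpha_1,\alpha_2,\beta\in\mathbb{C}$ are three parameters with $\mathrm{Re}(\alpha_1),\mathrm{Re}(\alpha_2)>0$, then the following integral inequality is valid for all $t>0$: $$\frac{\gamma(\alpha_2,\beta t)}{\beta^{\alpha_2}\Gamma(\alpha_2)}\,{}^{T}_{0}I_t^{(\alpha_1,\beta)}[f(t)g(t)]+\frac{\gamma(\alpha_1,\beta t)}{\beta^{\alpha_1}\Gamma(\alpha_1)}\,{}^{T}_{0}I_t^{(\alpha_2,\beta)}[f(t)g(t)]\ \ge\ {}^{T}_{0}I_t^{(\alpha_1,\beta)}[f(t)]\;{}^{T}_{0}I_t^{(\alpha_2,\beta)}[g(t)]+{}^{T}_{0}I_t^{(\alpha_1,\beta)}[g(t)]\;{}^{T}_{0}I_t^{(\alpha_2,\beta)}[f(t)].$$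
   Context: The tempered fractional integral, defined for $\mathrm{Re}(\alpha)>0$ and $\mathrm{Re}(\beta)\ge0$, is ${}^{T}_{0}I^{(\alpha,\beta)}_t[h(t)]=\frac{1}{\Gamma(\alpha)}\int_0^t (t-u)^{\alpha-1}e^{-\beta(t-u)}h(u)\,du$. Two real functions $f,g$ defined on an interval (here $[0,\infty)$) are synchronous if $(f(u)-f(v))(g(u)-g(v))\ge0$ for all $u,v$ in that interval. $\gamma(p,x)=\int_0^x w^{p-1}e^{-w}\,dw$ is the lower incomplete gamma function.
   Formalization: The parameters α₁, α₂, β are taken real (the inequality fails e.g. for α₁=α₂=1, β=i, t=π, f=g=1 on [0,π/2] and 0 elsewhere), β≠0 is required, and the six tempered integrals are assumed to converge absolutely at t, which f,g∈L¹ does not guarantee. *)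

(* Defs.v *)
From mathcomp Require Import all_boot all_order all_algebra.
From mathcomp Require Import complex.
From mathcomp Require Import all_classical all_reals all_analysis.

Set Implicit Arguments.
Unset Strict Implicit.
Unset Printing Implicit Defensive.

Import Order.TTheory GRing.Theory Num.Theory.

Local Open Scope classical_set_scope.
Local Open Scope ring_scope.
Local Open Scope complex_scope.

Section ComplexFunctions.
Variable R : realType.
Implicit Types z p : R[i].

Definition cexp z : R[i] :=
  (expR (complex.Re z))%:C * (cos (complex.Im z) +i* sin (complex.Im z)).

Definition cmod z : R := Num.sqrt (complex.Re z ^+ 2 + complex.Im z ^+ 2).

(* Principal argument, in ]-pi, pi]; meaningful only for z != 0. *)
Definition carg z : R :=
  if 0 <= complex.Im z then acos (complex.Re z / cmod z)
  else - acos (complex.Re z / cmod z).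

(* Principal logarithm; meaningful only for z != 0. *)
Definition clog z : R[i] := ln (cmod z) +i* carg z.

(* Principal branch of z ^ p; the value at z = 0 follows the convention of
   the real power [powR]. *)
Definition cpow z p : R[i] :=
  if z == 0 then (p == 0)%:R else cexp (p * clog z).

End ComplexFunctions.

Section ComplexIntegral.
Variable R : realType.

Definition cintegrable (D : set R) (h : R -> R[i]) : Prop :=
  (@lebesgue_measure R).-integrable D (fun u => (complex.Re (h u))%:E) /\
  (@lebesgue_measure R).-integrable D (fun u => (complex.Im (h u))%:E).

(* Meaningful only when [cintegrable D h] holds. *)
Definition cintegral (D : set R) (h : R -> R[i]) : R[i] :=
  (\int[@lebesgue_measure R]_(u in D) complex.Re (h u)) +i*
  (\int[@lebesgue_measure R]_(u in D) complex.Im (h u)).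

End ComplexIntegral.

Section TemperedIntegral.
Variable R : realType.
Implicit Types (z p x alpha beta : R[i]) (t u w : R) (h : R -> R[i]).

(* Euler's integral, for Re z > 0. *)
Definition cGamma z : R[i] :=
  cintegral `[0, +oo[ (fun w => cpow w%:C (z - 1) * cexp (- w%:C)).

(* The integral of w ^ (p - 1) * exp (- w) from 0 to x, for Re p > 0, taken
   along the segment w = s * x with 0 <= s <= 1. *)
Definition lower_incomplete_gamma p x : R[i] :=
  cintegral `[0, 1]
    (fun s : R => cpow (s%:C * x) (p - 1) * cexp (- (s%:C * x)) * x).

Definition tempered_integrand alpha beta t h : R -> R[i] :=
  fun u => cpow (t - u)%:C (alpha - 1) * cexp (- (beta * (t - u)%:C)) * h u.

(* The integral defining the tempered fractional integral of h at t exists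
   (absolutely, in the Lebesgue sense). *)
Definition tempered_exists alpha beta t h : Prop :=
  cintegrable `[0, t] (tempered_integrand alpha beta t h).

(* The tempered fractional integral of h at t, for Re alpha > 0 and
   Re beta >= 0; meaningful only when [tempered_exists alpha beta t h]. *)
Definition tempered_integral alpha beta t h : R[i] :=
  (cGamma alpha)^-1 * cintegral `[0, t] (tempered_integrand alpha beta t h).

Definition synchronous (D : set R) (f g : R -> R) : Prop :=
  forall u v, D u -> D v -> 0 <= (f u - f v) * (g u - g v).

End TemperedIntegral.

(* Main.v *)
Require Import Defs.
From mathcomp Require Import all_boot all_order all_algebra.
From mathcomp Require Import complex.
From mathcomp Require Import all_classical all_reals all_analysis.
From mathcomp Require Import measurable_realfun.
From mathcomp Require Import ring lra.

Import Order.TTheory GRing.Theory Num.Theory.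
Import numFieldNormedType.Exports.

Local Open Scope classical_set_scope.
Local Open Scope ring_scope.
Local Open Scope complex_scope.

(** All the parameters are real, so the inequality lives in R.  Writing
    [k_i x = x ^ (a_i - 1) * exp (- b x)] for the kernel of the i-th tempered
    integral, the factor gamma(a_i, b t) / b ^ a_i is the total mass of the
    weight [k_i (t - u)] on [0, t]: the substitution u = t - t s turns one
    integral into the other ([Rintegral_incomplete_gamma_integrand]).  Up to
    the common nonnegative factor 1 / (Gamma(a_1) Gamma(a_2)), the claim is
    Chebyshev's integral inequality for the two weights k_1 and k_2, which says
    that k_1(t - u) k_2(t - v) (f u - f v) (g u - g v) has a nonnegative double
    integral.

    In [weighted_chebyshev] this double integral is taken as an iterated one:
    after integration in u, the integrand is a linear combination of four
    integrable functions of v, so linearity of the integral suffices and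
    Fubini's theorem is avoided.  Linearity does require both weights to have
    finite mass ([integrable_tempered_kernelB]), which for a_i < 1 rests on the
    integrability of x ^ (a_i - 1) at the origin ([integral_powR_lty]). *)

(** * Chebyshev's integral inequality with two weights *)

Section WeightedChebyshev.
Context {d : measure_display} {T : measurableType d} {R : realType}.
Context (mu : {measure set T -> \bar R}) (D : set T) (mD : measurable D).
Implicit Types h p q f g : T -> R.

Let integrableZ (c : R) h : mu.-integrable D (EFin \o h) ->
  mu.-integrable D (EFin \o (fun u => c * h u)).
Proof. by move=> ih; exact: (@integrableZl _ _ _ mu D mD c _ ih). Qed.

Let integrable_add h1 h2 : mu.-integrable D (EFin \o h1) ->
  mu.-integrable D (EFin \o h2) ->
  mu.-integrable D (EFin \o (fun u => h1 u + h2 u)).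
Proof. by move=> i1 i2; exact: (integrableD mD i1 i2). Qed.

Lemma Rintegral_lincomb4 h1 h2 h3 h4 (c1 c2 c3 c4 : R) :
  mu.-integrable D (EFin \o h1) -> mu.-integrable D (EFin \o h2) ->
  mu.-integrable D (EFin \o h3) -> mu.-integrable D (EFin \o h4) ->
  \int[mu]_(u in D) (c1 * h1 u + c2 * h2 u + c3 * h3 u + c4 * h4 u) =
  c1 * (\int[mu]_(u in D) h1 u) + c2 * (\int[mu]_(u in D) h2 u)
  + c3 * (\int[mu]_(u in D) h3 u) + c4 * (\int[mu]_(u in D) h4 u).
Proof.
move=> i1 i2 i3 i4.
have [j1 j2] := (integrableZ c1 _ i1, integrableZ c2 _ i2).
have [j3 j4] := (integrableZ c3 _ i3, integrableZ c4 _ i4).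
have j12 := integrable_add _ _ j1 j2.
have j123 := integrable_add _ _ j12 j3.
rewrite (RintegralD mD j123 j4) (RintegralD mD j12 j3) (RintegralD mD j1 j2).
by rewrite !RintegralZl.
Qed.

(** The right side minus the left side is the iterated integral, first in [u],
    then in [v], of [p u * q v * ((f u - f v) * (g u - g v))]; expanding the
    product turns the integral in [u] into a combination of [PFG], [PF], [PG]
    and [P] below, with coefficients depending on [v]. *)
Lemma weighted_chebyshev p q f g :
  (forall u, D u -> 0 <= p u) -> (forall u, D u -> 0 <= q u) ->
  (forall u v, D u -> D v -> 0 <= (f u - f v) * (g u - g v)) ->
  mu.-integrable D (EFin \o p) -> mu.-integrable D (EFin \o q) ->
  mu.-integrable D (EFin \o (fun u => p u * f u)) ->
  mu.-integrable D (EFin \o (fun u => q u * f u)) ->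
  mu.-integrable D (EFin \o (fun u => p u * g u)) ->
  mu.-integrable D (EFin \o (fun u => q u * g u)) ->
  mu.-integrable D (EFin \o (fun u => p u * (f u * g u))) ->
  mu.-integrable D (EFin \o (fun u => q u * (f u * g u))) ->
  (\int[mu]_(u in D) (p u * f u)) * (\int[mu]_(u in D) (q u * g u))
  + (\int[mu]_(u in D) (p u * g u)) * (\int[mu]_(u in D) (q u * f u)) <=
  (\int[mu]_(u in D) q u) * (\int[mu]_(u in D) (p u * (f u * g u)))
  + (\int[mu]_(u in D) p u) * (\int[mu]_(u in D) (q u * (f u * g u))).
Proof.
move=> p0 q0 fg0 ip iq ipf iqf ipg iqg ipfg iqfg.
set P := \int[mu]_(u in D) p u; set Q := \int[mu]_(u in D) q u.
set PF := \int[mu]_(u in D) (p u * f u).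
set PG := \int[mu]_(u in D) (p u * g u).
set PFG := \int[mu]_(u in D) (p u * (f u * g u)).
have inner_ge0 v : D v -> 0 <= PFG - g v * PF - f v * PG + f v * g v * P.
  move=> Dv.
  have -> : PFG - g v * PF - f v * PG + f v * g v * P =
      \int[mu]_(u in D) (p u * ((f u - f v) * (g u - g v))).
    transitivity (1 * PFG + (- g v) * PF + (- f v) * PG + (f v * g v) * P).
      by ring.
    rewrite -Rintegral_lincomb4//; apply: eq_Rintegral => u _; ring.
  by apply: Rintegral_ge0 => u Du; rewrite mulr_ge0 ?p0 ?fg0.
rewrite -subr_ge0.
set QF := \int[mu]_(u in D) (q u * f u).
set QG := \int[mu]_(u in D) (q u * g u).
set QFG := \int[mu]_(u in D) (q u * (f u * g u)).
have -> : Q * PFG + P * QFG - (PF * QG + PG * QF) =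
    \int[mu]_(v in D) (q v * (PFG - g v * PF - f v * PG + f v * g v * P)).
  transitivity (PFG * Q + (- PF) * QG + (- PG) * QF + P * QFG); first by ring.
  rewrite -Rintegral_lincomb4//; apply: eq_Rintegral => u _; ring.
by apply: Rintegral_ge0 => v Dv; rewrite mulr_ge0 ?q0 ?inner_ge0.
Qed.

End WeightedChebyshev.

(** * Affine substitution on the Lebesgue measure *)

Section Reflection.
Context {R : realType}.
Local Notation mu := (@lebesgue_measure R).

Let reflection (c r : R) : measurableTypeR R -> measurableTypeR R :=
  fun s => c - r * s.

Let measurable_reflection c r : measurable_fun setT (reflection c r).
Proof.
apply: (@measurable_funD _ R R) => //.
by apply: measurableT_comp => //; exact: measurable_funM.
Qed.

Let preimage_reflection c r (b1 b2 : bool) (a b : R) : 0 < r ->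
  reflection c r @^-1` [set` Interval (BSide b1 a) (BSide b2 b)] =
  [set` Interval (BSide (~~ b2) ((c - b) / r)) (BSide (~~ b1) ((c - a) / r))].
Proof.
move=> r0; apply/seteqP; split=> s /=; rewrite !in_itv/= /reflection;
by case: b1 b2 => -[] /=; rewrite ?ler_pdivrMr ?ler_pdivlMr ?ltr_pdivrMr
  ?ltr_pdivlMr// => /andP[? ?]; apply/andP; split; lra.
Qed.

(** The substitution u = t - t s, obtained from the uniqueness of the Lebesgue
    measure on intervals instead of differentiation: this allows integrands
    that are unbounded near u = t, such as the tempered kernel. *)
Lemma ge0_integral_reflection (t : R) (h : R -> \bar R) : 0 < t ->
  measurable_fun `[0, t] h -> (forall u, `[0, t]%classic u -> (0 <= h u)%E) ->
  (\int[mu]_(u in `[0%R, t]) h u =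
   t%:E * \int[mu]_(s in `[0%R, 1%R]) h (t - t * s)%R)%E.
Proof.
move=> t0 mh h0.
have -> : `[0, 1]%classic = reflection t t @^-1` `[0, t].
  by rewrite preimage_reflection//= subrr mul0r subr0 divff// gt_eqF.
pose mphi := measurable_reflection t t.
rewrite -(@ge0_integral_pushforward _ _ _ _ R _ mphi mu)//=; last first.
  by move=> y /set_mem /h0.
(* Both t times the image measure and the Lebesgue measure give length b - a to
   the interval ]a, b]. *)
have tge0 := ltW t0.
pose tn : {nonneg R} := NngNum tge0.
rewrite -[t%:E]/((tn%:num)%:E).
have [nu nuE] : exists nu : {measure set (measurableTypeR R) -> \bar R},
    (nu : set _ -> _) = pushforward mu (reflection t t).
  by unshelve eexists (pushforward mu (reflection t t)); [exact: mphi|].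
transitivity (\int[mscale tn nu]_(u in `[0%R, t]) h u)%E; last first.
  by rewrite ge0_integral_mscale// nuE.
apply: eq_measure_integral => A mA _.
apply: lebesgue_measure_unique => //= _ [[a b]] _ <-.
rewrite /mscale nuE /pushforward/= preimage_reflection//=.
rewrite !lebesgue_measure_itv/= !lte_fin.
rewrite ltr_pM2r ?invr_gt0// ltrD2l ltrN2; case: ifP => _; last by rewrite mule0.
by rewrite -EFinB -EFinM; congr EFin; field; rewrite gt_eqF.
Qed.

End Reflection.

(** * The tempered kernel *)

Section Kernel.
Context {R : realType}.
Local Notation mu := (@lebesgue_measure R).

(** On [1/n, 1] the primitive x ^ a / a bounds the integral by 1/a, uniformly
    in n; monotone convergence does the rest. *)
Lemma integral_powR_lty (a : R) : 0 < a ->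
  (\int[mu]_(x in `[0%R, 1%R]) (x `^ (a - 1))%:E < +oo)%E.
Proof.
move=> a0.
pose F (n : nat) : set R := `[n.+1%:R^-1, 1]%classic.
have mpow (D : set R) : measurable_fun D (fun x : R => (x `^ (a - 1))%:E).
  by apply/measurable_EFinP; apply: measurable_funTS; exact: measurable_powR.
have bigF : \bigcup_n F n = `]0, 1]%classic.
  apply/seteqP; split=> [x [n _]|x]; rewrite /F/= !in_itv/= => /andP[x0 x1].
    by rewrite x1 (lt_le_trans _ x0)// invr_gt0.
  exists (Num.truncn x^-1) => //=; rewrite in_itv/= x1 andbT.
  rewrite invf_ple ?posrE//; apply/ltW; exact: truncnS_gt.
(* The intervals F n exhaust only ]0, 1]; the point 0 is a null set. *)
rewrite -integral_itv_obnd_cbnd// -bigF.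
have step n : (\int[mu]_(x in F n) (x `^ (a - 1))%:E <= (a^-1)%:E)%E.
  case: n => [|n].
    by rewrite /F invr1 set_itv1 integral_set1 lee_fin invr_ge0 ltW.
  have pos : 0 < n.+2%:R^-1 :> R by rewrite invr_gt0.
  rewrite (@continuous_FTC2 _ _ (fun x => a^-1 * x `^ a)).
  - rewrite -EFinB lee_fin powR1 mulr1 lerBlDr lerDl.
    by rewrite mulr_ge0 ?powR_ge0// invr_ge0 ltW.
  - by rewrite invf_lt1// ltr1n.
  - apply: derivable_within_continuous => x; rewrite in_itv/= => /andP[xn _].
    by apply: derivable_powR; rewrite in_itv/= andbT (lt_le_trans pos).
  - have der x : 0 < x -> derivable (fun x : R => a^-1 * x `^ a) x 1.
      move=> x0; apply: derivableM => //.
      by apply: derivable_powR; rewrite in_itv/= x0.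
    have cont x : 0 < x -> {for x, continuous (fun x : R => a^-1 * x `^ a)}.
      by move=> /der /derivable1_diffP /differentiable_continuous.
    split.
    + by move=> x; rewrite in_itv/= => /andP[xn _]; exact: der (lt_trans pos xn).
    + exact/cvg_at_right_filter/cont.
    + exact/cvg_at_left_filter/cont.
  - move=> x; rewrite in_itv/= => /andP[xn _].
    have x0 := lt_trans pos xn.
    rewrite derive1E deriveZ//=; last by apply: derivable_powR; rewrite in_itv/= x0.
    rewrite -derive1E powR_derive1 ?in_itv/= ?x0//.
    by rewrite /GRing.scale/= mulrA mulVf ?mul1r// gt_eqF.
apply: (@le_lt_trans _ _ (a^-1)%:E); last exact: ltry.
have ndF : nondecreasing_seq F.
  move=> m n mn; apply/subsetPset => x; rewrite /F/= !in_itv/= => /andP[xm ->].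
  by rewrite andbT (le_trans _ xm)// lef_pV2 ?posrE// ler_nat.
have cvgF : (\int[mu]_(x in F i) (x `^ (a - 1))%:E @[i --> \oo] -->
    \int[mu]_(x in \bigcup_i F i) (x `^ (a - 1))%:E)%E.
  have mF i : @measurable _ (measurableTypeR R) (F i) by exact: measurable_itv.
  apply: (@ge0_nondecreasing_set_cvg_integral _ (measurableTypeR R) R F
    (fun x : R => (x `^ (a - 1))%:E) _ ndF mF); first by move=> i; exact: mpow.
  by move=> i x _; rewrite lee_fin powR_ge0.
rewrite -(cvg_lim _ cvgF)//.
apply: lime_le; last exact: nearW.
by apply/cvg_ex; eexists; exact: cvgF.
Qed.

Definition tempered_kernel (a b x : R) : R := x `^ (a - 1) * expR (- (b * x)).

Lemma tempered_kernel_ge0 a b x : 0 <= tempered_kernel a b x.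
Proof. by rewrite mulr_ge0 ?powR_ge0 ?expR_ge0. Qed.

Lemma measurable_tempered_kernel a b :
  measurable_fun setT (tempered_kernel a b).
Proof.
apply: (@measurable_funM _ R R setT (fun x => x `^ (a - 1))).
  exact: measurable_powR.
by apply: measurableT_comp => //; apply: measurableT_comp.
Qed.

Lemma measurable_tempered_kernelB (a b t : R) :
  measurable_fun setT (fun u : R => tempered_kernel a b (t - u)).
Proof.
apply: (measurableT_comp (measurable_tempered_kernel a b)).
exact: measurable_funB.
Qed.

Lemma integral_tempered_kernelB (a b t : R) : 0 < t ->
  (\int[mu]_(u in `[0%R, t]) (tempered_kernel a b (t - u))%:E =
   t%:E * \int[mu]_(s in `[0%R, 1%R]) (tempered_kernel a b (t * s))%:E)%E.
Proof.
move=> t0; rewrite ge0_integral_reflection//.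
- congr (_ * _)%E; apply: eq_integral => s _; congr (_%:E); congr tempered_kernel.
  ring.
- apply/measurable_EFinP; apply: measurable_funTS.
  exact: measurable_tempered_kernelB.
- by move=> u _; rewrite lee_fin tempered_kernel_ge0.
Qed.

(** The exponential is at most 1, so the power alone bounds the kernel. *)
Lemma integrable_tempered_kernelB (a b t : R) : 0 < a -> 0 <= b -> 0 < t ->
  mu.-integrable `[0, t] (EFin \o (fun u => tempered_kernel a b (t - u))).
Proof.
move=> a0 b0 t0; apply/integrableP; split.
  apply/measurable_EFinP; apply: measurable_funTS.
  exact: measurable_tempered_kernelB.
under eq_integral do rewrite /= ger0_norm ?tempered_kernel_ge0//.
rewrite integral_tempered_kernelB// lte_mul_pinfty// ?lee_fin ?(ltW t0)//.
apply: (@le_lt_trans _ _ (\int[mu]_(s in `[0%R, 1%R])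
    ((t `^ (a - 1))%:E * (s `^ (a - 1))%:E)))%E.
  apply: ge0_le_integral => //.
  - by move=> s _; rewrite lee_fin tempered_kernel_ge0.
  - apply/measurable_EFinP; apply: measurable_funTS.
    apply: (measurableT_comp (measurable_tempered_kernel a b)).
    exact: measurable_funM.
  - apply/measurable_EFinP; apply: measurable_funM => //; apply: measurable_funTS.
    exact: measurable_powR.
  - move=> s /=; rewrite in_itv/= => /andP[s0 _].
    rewrite -EFinM lee_fin /tempered_kernel powRM ?(ltW t0)//.
    rewrite ler_piMr ?mulr_ge0 ?powR_ge0// -expR0 ler_expR oppr_le0.
    by rewrite !mulr_ge0// ltW.
rewrite ge0_integralZl_EFin ?powR_ge0//.
- by rewrite lte_mul_pinfty ?lee_fin ?powR_ge0// integral_powR_lty.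
- by move=> s _; rewrite lee_fin powR_ge0.
- by apply/measurable_EFinP; apply: measurable_funTS; exact: measurable_powR.
Qed.

(** With x = s b t = b (t s), homogeneity of the power produces the factor
    b ^ (a - 1) and the differential of x contributes b t, whose factor t is the
    Jacobian of u = t - t s. *)
Lemma Rintegral_incomplete_gamma_integrand (a b t : R) :
  0 < a -> 0 < b -> 0 < t ->
  \int[mu]_(s in `[0, 1])
    ((s * (b * t)) `^ (a - 1) * expR (- (s * (b * t))) * (b * t)) =
  b `^ a * \int[mu]_(u in `[0, t]) tempered_kernel a b (t - u).
Proof.
move=> a0 b0 t0.
have intk := integrable_tempered_kernelB _ _ _ a0 (ltW b0) t0.
rewrite -[b `^ a]/(fine (b `^ a)%:E) -fineM//; last first.
  exact: integrable_fin_num intk.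
congr fine; rewrite [RHS](_ : _ = ((b `^ a)%:E *
  (t%:E * \int[mu]_(s in `[0%R, 1%R]) (tempered_kernel a b (t * s))%:E))%E).
  2: by rewrite -integral_tempered_kernelB.
rewrite muleA -EFinM -ge0_integralZl_EFin//.
- apply: eq_integral => s /set_mem; rewrite /= in_itv/= => /andP[s0 _].
  rewrite -EFinM; congr EFin; rewrite /tempered_kernel -(mulr_powRB1 (ltW b0) a0).
  rewrite !powRM ?mulr_ge0 ?(ltW b0) ?(ltW t0)//.
  rewrite (_ : s * (b * t) = b * (t * s)); ring.
- by move=> s _; rewrite lee_fin tempered_kernel_ge0.
- apply/measurable_EFinP; apply: measurable_funTS.
  apply: (measurableT_comp (measurable_tempered_kernel a b)).
  exact: measurable_funM.
- by rewrite mulr_ge0 ?powR_ge0// ltW.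
Qed.

End Kernel.

(** * Complex definitions at real parameters *)

Section RealParameters.
Context {R : realType}.
Local Notation mu := (@lebesgue_measure R).
Implicit Types (a b t : R) (h : R -> R).

Lemma cexp_real a : cexp a%:C = (expR a)%:C.
Proof. by rewrite /cexp/= cos0 sin0 mulr1. Qed.

Lemma clog_real a : 0 < a -> clog a%:C = (ln a)%:C.
Proof.
move=> a0; rewrite /clog /carg /cmod/= lexx expr0n/= addr0 sqrtr_sqr gtr0_norm//.
by rewrite divff ?gt_eqF// acos1.
Qed.

Lemma cpow_real a p : 0 <= a -> cpow a%:C p%:C = (a `^ p)%:C.
Proof.
move=> a0; rewrite /cpow /powR (inj_eq (@complexI _)).
have [_|an0] := eqVneq a 0.
  by rewrite (inj_eq (@complexI _)) rmorph_nat.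
by rewrite clog_real ?lt0r ?an0// -rmorphM cexp_real.
Qed.

Lemma cintegral_real D (H : R -> R[i]) h : (forall u, D u -> H u = (h u)%:C) ->
  cintegral D H = (\int[mu]_(u in D) h u)%:C.
Proof.
move=> Hh; rewrite /cintegral.
have -> : \int[mu]_(u in D) complex.Re (H u) = \int[mu]_(u in D) h u.
  by apply: eq_Rintegral => u /set_mem /Hh ->.
suff -> : \int[mu]_(u in D) complex.Im (H u) = 0 by [].
rewrite /Rintegral integral0_eq// => u /Hh ->//.
Qed.

(** This is Euler's integral: the tempered kernel with b = 1 is the integrand of
    the Gamma function. *)
Definition rGamma a : R := \int[mu]_(w in `[0, +oo[) tempered_kernel a 1 w.

Lemma rGamma_ge0 a : 0 <= rGamma a.
Proof. by apply: Rintegral_ge0 => w _; exact: tempered_kernel_ge0. Qed.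

Lemma cGamma_real a : cGamma a%:C = (rGamma a)%:C.
Proof.
apply: cintegral_real => w; rewrite /= in_itv/= andbT => w0.
rewrite -(rmorph1 (real_complex R)) -rmorphB -rmorphN.
by rewrite cexp_real cpow_real// -rmorphM/= /tempered_kernel mul1r.
Qed.

Lemma tempered_integrand_real a b t h u : u \in `[0, t] ->
  tempered_integrand a%:C b%:C t (fun u => (h u)%:C) u =
  (tempered_kernel a b (t - u) * h u)%:C.
Proof.
rewrite in_itv/= => /andP[_ ut]; rewrite /tempered_integrand.
rewrite -[in X in cpow _ X](rmorph1 (real_complex R)).
rewrite -!(rmorphB, rmorphM, rmorphN).
by rewrite cexp_real cpow_real ?subr_ge0// -!rmorphM.
Qed.

Lemma tempered_integral_real a b t h :
  tempered_integral a%:C b%:C t (fun u => (h u)%:C) =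
  ((rGamma a)^-1
   * \int[mu]_(u in `[0, t]) (tempered_kernel a b (t - u) * h u))%:C.
Proof.
rewrite /tempered_integral cGamma_real [RHS]rmorphM/= fmorphV; congr (_ * _).
by apply: cintegral_real => u ut; exact: tempered_integrand_real.
Qed.

Lemma tempered_exists_real a b t h :
  tempered_exists a%:C b%:C t (fun u => (h u)%:C) ->
  mu.-integrable `[0, t] (EFin \o (fun u => tempered_kernel a b (t - u) * h u)).
Proof.
move=> [+ _]; apply: eq_integrable => // u /set_mem ut /=.
by rewrite tempered_integrand_real.
Qed.

Lemma lower_incomplete_gamma_real a b t : 0 < a -> 0 < b -> 0 < t ->
  lower_incomplete_gamma a%:C (b%:C * t%:C) =
  (b `^ a * \int[mu]_(u in `[0, t]) tempered_kernel a b (t - u))%:C.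
Proof.
move=> a0 b0 t0; rewrite -Rintegral_incomplete_gamma_integrand//.
apply: cintegral_real => s; rewrite /= in_itv/= => /andP[s0 _].
rewrite -[in X in cpow _ X](rmorph1 (real_complex R)).
rewrite -!(rmorphB, rmorphM, rmorphN).
rewrite cexp_real cpow_real; last by rewrite !mulr_ge0// ltW.
by rewrite -!rmorphM.
Qed.

End RealParameters.

(** * The inequality for tempered fractional integrals *)

Theorem theorem4p3 (R : realType) (f g : R -> R) (alpha1 alpha2 beta : R[i])
    (f_L1 : (@lebesgue_measure R).-integrable `[0, +oo[ (fun u => (f u)%:E))
    (g_L1 : (@lebesgue_measure R).-integrable `[0, +oo[ (fun u => (g u)%:E))
    (fg_sync : synchronous `[0, +oo[ f g)
    (alpha1_gt0 : 0 < complex.Re alpha1) (alpha2_gt0 : 0 < complex.Re alpha2)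
    (beta_ge0 : 0 <= complex.Re beta) (beta_neq0 : beta != 0)
    (* "<=" between the two sides requires real parameters *)
    (alpha1_real : alpha1 \is Num.real) (alpha2_real : alpha2 \is Num.real)
    (beta_real : beta \is Num.real)
    (t : R) (t_gt0 : 0 < t)
    (* the six tempered integrals at t exist *)
    (fg1_ex : tempered_exists alpha1 beta t (fun u => (f u * g u)%:C))
    (fg2_ex : tempered_exists alpha2 beta t (fun u => (f u * g u)%:C))
    (f1_ex : tempered_exists alpha1 beta t (fun u => (f u)%:C))
    (f2_ex : tempered_exists alpha2 beta t (fun u => (f u)%:C))
    (g1_ex : tempered_exists alpha1 beta t (fun u => (g u)%:C))
    (g2_ex : tempered_exists alpha2 beta t (fun u => (g u)%:C)) :
  lower_incomplete_gamma alpha2 (beta * t%:C) / (cpow beta alpha2 * cGamma alpha2)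
      * tempered_integral alpha1 beta t (fun u => (f u * g u)%:C)
  + lower_incomplete_gamma alpha1 (beta * t%:C) / (cpow beta alpha1 * cGamma alpha1)
      * tempered_integral alpha2 beta t (fun u => (f u * g u)%:C)
  >= tempered_integral alpha1 beta t (fun u => (f u)%:C)
       * tempered_integral alpha2 beta t (fun u => (g u)%:C)
     + tempered_integral alpha1 beta t (fun u => (g u)%:C)
       * tempered_integral alpha2 beta t (fun u => (f u)%:C).
Proof.
move: alpha1_real alpha2_real beta_real => /complex_realP[a1 a1E].
move=> /complex_realP[a2 a2E] /complex_realP[b bE]; subst alpha1 alpha2 beta.
move: alpha1_gt0 alpha2_gt0 beta_ge0 => /= a1_gt0 a2_gt0 b_ge0.
have b_gt0 : 0 < b by rewrite lt0r b_ge0 andbT -(inj_eq (@complexI _)).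
rewrite !lower_incomplete_gamma_real// !tempered_integral_real !cpow_real//.
rewrite !cGamma_real -!(rmorphM, fmorphV, rmorphD) lecR.
have cancel_powb a (x y : R) : b `^ a * x / (b `^ a * y) = x / y.
  by rewrite invfM mulrACA divff ?mul1r// gt_eqF// powR_gt0.
rewrite !cancel_powb.
have G_ge0 : 0 <= (rGamma a1)^-1 * (rGamma a2)^-1.
  by rewrite mulr_ge0 ?invr_ge0 ?rGamma_ge0.
have int_k a := integrable_tempered_kernelB a b t.
have k_ge0 a u : 0 <= tempered_kernel a b (t - u) by exact: tempered_kernel_ge0.
have sync u v : `[0, t]%classic u -> `[0, t]%classic v ->
    0 <= (f u - f v) * (g u - g v).
  rewrite /= !in_itv/= => /andP[u0 _] /andP[v0 _].
  by apply: fg_sync; rewrite /= in_itv/= ?u0 ?v0.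
have := @weighted_chebyshev _ (measurableTypeR R) R _ `[0, t]
  (measurable_itv _) _ _ f g
  (fun u _ => k_ge0 a1 u) (fun u _ => k_ge0 a2 u) sync
  (int_k a1 a1_gt0 b_ge0 t_gt0) (int_k a2 a2_gt0 b_ge0 t_gt0)
  (tempered_exists_real _ _ _ _ f1_ex) (tempered_exists_real _ _ _ _ f2_ex)
  (tempered_exists_real _ _ _ _ g1_ex) (tempered_exists_real _ _ _ _ g2_ex)
  (tempered_exists_real _ _ _ _ fg1_ex) (tempered_exists_real _ _ _ _ fg2_ex).
move=> /(ler_wpM2l G_ge0).
by congr (_ <= _); ring.
Qed.
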